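(* Let $(\Omega,\mathcal F,(\mathcal F_A)_{A\in\mathcal A},\mathbb P)$ be a complete probability space with a set-indexed filtration, and let $X=\{X_A;A\in\mathcal A\}$ be an $E$-valued $\mathcal C$-Markov process w.r.t. $(\mathcal F_A)_{A\in\mathcal A}$. Suppose that $(\mathcal F_A)_{A\in\mathcal A}$ is included in the $\sigma$-field $\mathcal F^0_\infty:=\sigma(\{X_A;A\in\mathcal A\})$. Then the filtration $(\mathcal F_A)_{A\in\mathcal A}$ satisfies the conditional independence property: for all $U,V\in\mathcal A$ and any bounded random variable $Y$ on $(\Omega,\mathcal F^0_\infty,\mathbb P)$, $$\mathbb E\big[\mathbb E[Y\mid\mathcal F_U]\mid\mathcal F_V\big]=\mathbb E\big[\mathbb E[Y\mid\mathcal F_V]\mid\mathcal F_U\big]=\mathbb E[Y\mid\mathcal F_{U\cap V}]\quad\mathbb P\text{-a.s.}$$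
   Context: Indexing collection. $\mathcal T$ is a locally compact metric space and $(E,d_E)$ is a locally compact separable metric space with Borel $\sigma$-field $\mathcal E$. The indexing collection $\mathcal A$ is a class of compact subsets of $\mathcal T$ such that: (i) $\mathcal A$ is closed under arbitrary intersections and $A^\circ\neq A$ for all $A\in\mathcal A$, $A\neq\mathcal T$; (ii) $\emptyset':=\bigcap_{A\in\mathcal A}A$ is nonempty; (iii) there is an increasing sequence $(B_n)_{n\in\mathbf N}$ in $\mathcal A$ with $\mathcal T=\bigcup_nB_n$; (iv) (Shape) if $A,A_1,\dots,A_k\in\mathcal A$ and $A\subseteq\bigcup_{i=1}^kA_i$ then $A\subseteq A_i$ for some $i$. Increments. $\mathcal A(u)$ is the class of (nonempty) finite unions of sets of $\mathcal A$, and $\mathcal C$ is the class of increments $C=A\setminus B$, $A\in\mathcal A$, $B\in\mathcal A(u)$. To $C$ one associates $A$ and $B$ with $C=A\setminus B$, $B\subseteq A$, $B=\bigcup_{i=1}^kA_i$ being the extremal representation ($A_i\in\mathcal A$, $A_i\not\subseteq A_j$ for $i\ne j$). Let $\mathcal A_\ell$ be the set of all intersections of nonempty subfamilies of $\{A_1,\dots,A_k\}$, and $\mathcal A_C=\{U\in\mathcal A_\ell;\ U\not\subseteq B^\circ\}=\{U_C^1,\dots,U_C^p\}$, $p=|\mathcal A_C|$. For a process $X$, $\mathbf X_C=(X_{U_C^1},\dots,X_{U_C^p})$. Filtrations. A filtration $(\mathcal F_A)_{A\in\mathcal A}$ is an increasing family of sub-$\sigma$-fields; filtrations are always supposed complete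 (inclusion in $\mathcal F^0_\infty$ is understood up to null sets accordingly). For $B\in\mathcal A(u)$, $\mathcal F_B=\bigvee_{A\in\mathcal A,A\subseteq B}\mathcal F_A$, and for $C\in\mathcal C$, $\mathcal G^*_C=\bigvee_{B\in\mathcal A(u),\,B\cap C=\emptyset}\mathcal F_B$. $\mathcal C$-Markov property. An $E$-valued process $X=\{X_A;A\in\mathcal A\}$ is $\mathcal C$-Markov w.r.t. $(\mathcal F_A)$ if it is adapted and, for all $C=A\setminus B\in\mathcal C$ and all bounded measurable $f:E\to\mathbf R$, $\mathbb E[f(X_A)\mid\mathcal G^*_C]=\mathbb E[f(X_A)\mid\mathbf X_C]$ a.s. *)

(* Defs.v *)
From HB Require Import structures.
From mathcomp Require Import all_boot all_order all_algebra.
From mathcomp Require Import all_classical all_reals all_analysis.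
From mathcomp Require Import measurable_realfun.

Set Implicit Arguments.
Unset Strict Implicit.
Unset Printing Implicit Defensive.

Import Order.TTheory GRing.Theory Num.Theory.
Import numFieldNormedType.Exports.

Local Open Scope classical_set_scope.
Local Open Scope ring_scope.

Definition separable (T : topologicalType) :=
  exists2 S : set T, countable S & dense S.

Definition borel (T : topologicalType) : set (set T) := <<s @open T >>.

(* Measurability with respect to bare set systems, so that one function can be
   measured against the many sub-sigma-fields of a single space. *)
Definition measurable_wrt (T U : Type) (G : set (set T)) (H : set (set U))
    (f : T -> U) :=
  preimage_set_system setT f H `<=` G.

(* Conditional expectation given a sub-sigma-field G: a version chosen once and
   for all. Versions exist (cond_expP) and are a.s. equal
   (is_cond_exp_unique). *)
Section conditional_expectation.
Context d (W : measurableType d) (R : realType) (P : probability W R).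

Definition is_cond_exp (G : set (set W)) (Y Z : W -> R) :=
  [/\ measurable_wrt G (@measurable _ R) Z,
      P.-integrable setT (EFin \o Z) &
      forall B, G B -> (\int[P]_(w in B) (Z w)%:E = \int[P]_(w in B) (Y w)%:E)%E].

Definition cond_exp (G : set (set W)) (Y : W -> R) : W -> R :=
  xget (cst 0) [set Z | is_cond_exp G Y Z].

Lemma is_cond_exp_exists (G : set (set W)) (Y : W -> R) :
  sigma_algebra setT G -> G `<=` measurable ->
  P.-integrable setT (EFin \o Y) -> exists Z, is_cond_exp G Y Z.
Proof.
move=> sG GF iY; pose V := g_sigma_algebraType G.
have VE : @measurable _ V = G by exact: measurable_g_measurableTypeE.
pose h : W -> V := idfun.
have mh : measurable_fun [set: W] h.
  by move=> _ B mB; rewrite setTI; apply: GF; rewrite -VE.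
pose h' : {mfun W >-> V} := HB.pack h (isMeasurableFun.Build _ _ _ _ h mh).
pose Q : probability V R := distribution P h'.
pose nu : {charge set W -> \bar R} := induced_charge iY.
pose lam : set V -> \bar R := pushforward nu h.
pose lamC := isCharge.Build _ V R lam.
have lam0 : lam set0 = 0%E by rewrite /lam /pushforward preimage_set0 charge0.
have lamf B : measurable B -> lam B \is a fin_num.
  by move=> mB; apply: (@fin_num_measure _ _ _ nu B); apply: GF; rewrite -VE.
have lams : semi_sigma_additive lam.
  move=> B mB tB mUB; apply: (@charge_semi_sigma_additive _ _ _ nu B) => //.
  - by move=> n; apply: GF; rewrite -VE; exact: mB.
  - by apply: GF; rewrite -VE.
pose Lam : {charge set V -> \bar R} := HB.pack lam (lamC lam0 lamf lams).
have dom : Lam `<< Q.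
  apply/null_content_dominatesP => B mB QB0.
  have mB' : d.-measurable (B : set W) by apply: GF; rewrite -VE.
  change (\int[P]_(w in B) (EFin \o Y) w = 0)%E.
  apply: (@null_set_integral _ W R P B (EFin \o Y) mB') => //.
  move=> _ S mS; apply: measurableI => //.
  by have := measurable_int P iY measurableT S mS; rewrite setTI.
pose f := Radon_Nikodym Lam Q.
have ffin x : f x \is a fin_num by exact: Radon_Nikodym_fin_num.
have fi : Q.-integrable setT f by exact: Radon_Nikodym_integrable.
have fE : EFin \o (fine \o f) = f by apply/funext => x /=; rewrite fineK.
have mf0 := measurable_int Q fi.
have mf : measurable_fun [set: V] (fine \o f : V -> R).
  by apply/measurable_EFinP; rewrite fE.
have mfW : measurable_fun [set: W] (f : W -> \bar R).
  move=> _ S mS; rewrite setTI; apply: GF; rewrite -VE.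
  by have := mf0 measurableT S mS; rewrite setTI.
have fiP : P.-integrable [set: W] f.
  apply/integrableP; split => //.
  move/integrableP : fi => [mfV]; apply: le_lt_trans.
  rewrite ge0_integral_pushforward//.
  exact: measurableT_comp mfV.
exists (fine \o f); split.
- by move=> _ [B mB <-]; rewrite -VE; exact: mf.
- by rewrite fE.
- move=> B GB.
  have mB : measurable (B : set V) by rewrite VE.
  transitivity (\int[P]_(w in B) f w)%E.
    by apply: eq_integral => w _; rewrite /= fineK.
  transitivity (\int[Q]_(w in B) f w)%E; last first.
    by rewrite -[LHS]/(\int[Q]_(w in B) f w)%E -(Radon_Nikodym_integral dom mB).
  rewrite integral_pushforward //.
  by apply: integrableS fiP => //; apply: GF.
Qed.

Lemma cond_expP (G : set (set W)) (Y : W -> R) :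
  sigma_algebra setT G -> G `<=` measurable ->
  P.-integrable setT (EFin \o Y) -> is_cond_exp G Y (cond_exp G Y).
Proof.
move=> sG GF iY; have [Z hZ] := is_cond_exp_exists sG GF iY.
by rewrite /cond_exp; case: xgetP => [? _ //|/(_ Z)].
Qed.

Lemma is_cond_exp_unique (G : set (set W)) (Y Z1 Z2 : W -> R) :
  sigma_algebra setT G -> G `<=` measurable ->
  is_cond_exp G Y Z1 -> is_cond_exp G Y Z2 -> Z1 = Z2 %[ae P].
Proof.
move=> sG GF [m1 i1 e1] [m2 i2 e2].
have mW (Z : W -> R) : measurable_wrt G (@measurable _ R) Z ->
    forall B, measurable B -> G (Z @^-1` B).
  by move=> mZ B mB; apply: mZ; exists B => //; rewrite setTI.
pose V := g_sigma_algebraType G.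
have VE : @measurable _ V = G by exact: measurable_g_measurableTypeE.
pose h : W -> V := idfun.
have mh : measurable_fun [set: W] h.
  by move=> _ B mB; rewrite setTI; apply: GF; rewrite -VE.
pose h' : {mfun W >-> V} := HB.pack h (isMeasurableFun.Build _ _ _ _ h mh).
pose Q : probability V R := distribution P h'.
have mV (Z : W -> R) : measurable_wrt G (@measurable _ R) Z ->
    measurable_fun [set: V] (EFin \o Z : V -> \bar R).
  move=> mZ; apply/measurable_EFinP => _ B mB; rewrite setTI VE; exact: mW.
have iV (Z : W -> R) : measurable_wrt G (@measurable _ R) Z ->
    P.-integrable setT (EFin \o Z) ->
    Q.-integrable setT (EFin \o Z : V -> \bar R).
  by move=> mZ iZ; apply: integrable_pushforward => //; exact: mV.
have : ae_eq Q [set: V] (EFin \o Z1) (EFin \o Z2).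
  apply: integral_ae_eq => //; [exact: iV|exact: mV|].
  move=> B _ mB.
  have GB : G B by rewrite -VE.
  have iB (Z : W -> R) : P.-integrable setT (EFin \o Z) ->
      P.-integrable (h @^-1` B) ((EFin \o Z : V -> \bar R) \o h).
    by move=> iZ; apply: integrableS iZ => //; exact: GF.
  rewrite !integral_pushforward//; try exact: mV; try exact: iB.
  by rewrite [LHS](e1 _ GB) [RHS](e2 _ GB).
case=> N [mN N0 hN]; exists N; split => //; first by apply: GF; rewrite -VE.
move=> w /= hw; apply: hN => /= hw'; apply: hw => _.
by have [] := hw' I.
Qed.

End conditional_expectation.

Section set_indexed.
Variables (R : realType) (T : metricType R).
Variable calA : set (set T).

(* "Arbitrary intersections" are those of nonempty subfamilies: the empty one
   would put the whole space, possibly noncompact, in calA. *)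
Record indexing_collection : Prop := {
  idx_compact : forall A, calA A -> compact A ;
  idx_bigcap : forall S : set (set T), S !=set0 -> S `<=` calA ->
    calA (\bigcap_(A in S) A) ;
  idx_interior : forall A, calA A -> A <> setT -> A° <> A ;
  idx_min : \bigcap_(A in calA) A !=set0 ;
  idx_exhaust : exists B : nat -> set T,
    [/\ forall n, calA (B n),
        {homo B : m n / (m <= n)%N >-> m `<=` n} &
        \bigcup_n B n = setT] ;
  idx_shape : forall (A : set T) (D : set (set T)), calA A ->
    finite_set D -> D !=set0 -> D `<=` calA ->
    A `<=` \bigcup_(B in D) B -> exists2 B, D B & A `<=` B }.

Definition finite_unions : set (set T) :=
  [set B | exists D : set (set T),
    [/\ finite_set D, D !=set0, D `<=` calA & B = \bigcup_(A in D) A]].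

(* C = A \ B where the members of D are the terms of the extremal
   representation of B. *)
Record increment_rep (C A : set T) (D : set (set T)) : Prop := {
  inc_A : calA A ;
  inc_finite : finite_set D ;
  inc_neq0 : D !=set0 ;
  inc_sub : D `<=` calA ;
  inc_extremal : forall A1 A2, D A1 -> D A2 -> A1 <> A2 -> ~ (A1 `<=` A2) ;
  inc_subA : \bigcup_(B in D) B `<=` A ;
  inc_eq : C = A `\` \bigcup_(B in D) B }.

Definition meets (D : set (set T)) : set (set T) :=
  [set U | exists S : set (set T),
    [/\ S !=set0, S `<=` D & U = \bigcap_(A in S) A]].

Definition calA_C (D : set (set T)) : set (set T) :=
  [set U | meets D U /\ ~ (U `<=` (\bigcup_(B in D) B)°)].

Section process.
Context d (W : measurableType d) (P : probability W R).
Variable F : set T -> set (set W).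

(* F and X below are functions of arbitrary sets, but only their values on
   calA matter. *)
Record complete_filtration : Prop := {
  filt_sigma : forall A, calA A -> sigma_algebra setT (F A) ;
  filt_sub : forall A, calA A -> F A `<=` measurable ;
  filt_mono : forall A B, calA A -> calA B -> A `<=` B -> F A `<=` F B ;
  filt_complete : forall A, calA A -> P.-negligible `<=` F A }.

Definition filt_union (B : set T) : set (set W) :=
  <<s \bigcup_(A in [set A | calA A /\ A `<=` B]) F A >>.

Definition filt_star (C : set T) : set (set W) :=
  <<s \bigcup_(B in [set B | finite_unions B /\ B `&` C = set0])
        filt_union B >>.

Variables (E : metricType R) (X : set T -> W -> E).

Definition sigma_X (S : set (set T)) : set (set W) :=
  <<s \bigcup_(A in S) preimage_set_system setT (X A) (@borel E) >>.

(* C is required to be nonempty: A, B and the vector X_C are functions of C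
   only then. Since set0 = A \ A, allowing C = set0 would change nothing for
   A != setT, but would force X_setT to be a.s. constant when setT is in
   calA, calA_C being empty in that case. *)
Definition C_Markov : Prop :=
  (forall A, calA A -> measurable_wrt (F A) (@borel E) (X A)) /\
  (forall (C A : set T) (D : set (set T)) (f : E -> R),
    increment_rep C A D -> C !=set0 ->
    measurable_wrt (@borel E) (@measurable _ R) f ->
    [bounded f x | x in [set: E]] ->
    cond_exp P (filt_star C) (f \o X A) =
    cond_exp P (sigma_X (calA_C D)) (f \o X A) %[ae P]).

End process.
End set_indexed.

(* Main.v *)
(* For a finite family S of sets of calA closed under intersections, with
   A `&` V in S for all A in S, the members of S not included in V can be
   removed one at a time, each maximal in what remains. A removed set A yields
   a nonempty increment C = A minus the union of the remaining sets; C is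
   disjoint from V and from the remaining sets, so the C-Markov property says
   that X_A adds no information on F_V to that of the remaining variables.
   Hence F_V and sigma(X_A, A in S) are conditionally independent given
   sigma(X_A, A in S, A included in V). Conditioning a variable measurable for
   sigma(X_A, A in S) on F_V, then on F_U, thus amounts to conditioning it on
   sigma(X_A, A in S, A included in U `&` V), and so does conditioning it on
   F_(U `&` V). The general case follows since the sigma-fields
   sigma(X_A, A in S) form a pi-system generating sigma(X_A, A in calA), and
   conditional expectations are self-adjoint. *)

Require Import Defs.
From HB Require Import structures.
From mathcomp Require Import all_boot all_order all_algebra.
From mathcomp Require Import all_classical all_reals all_analysis.
From mathcomp Require Import measurable_realfun ring lra.

Set Implicit Arguments.
Unset Strict Implicit.
Unset Printing Implicit Defensive.

Import Order.TTheory GRing.Theory Num.Theory.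
Import numFieldNormedType.Exports.
Local Open Scope classical_set_scope.
Local Open Scope ring_scope.

(** * Conditional expectations of bounded variables, tested against bounded functions *)

Section bounded_conditional_expectation.
Context {d} {W : measurableType d} {R : realType}.
Implicit Types (G H : set (set W)) (f g h Y Z : W -> R).

(** The bound holds at every point, so the class is stable under sums and products and, when [G]
    consists of measurable sets, all its members are integrable. *)
Definition bounded_wrt G h :=
  measurable_wrt G (@measurable _ R) h /\ exists M, forall w, `|h w| <= M.

(** Viewing [G] as the sigma-field of its own measurable type gives access to the closure properties
    of [measurable_fun]. *)
Lemma measurable_wrtP G h : sigma_algebra setT G ->
  measurable_wrt G (@measurable _ R) h <->
  measurable_fun [set: g_sigma_algebraType G]
    (h : g_sigma_algebraType G -> R).
Proof.
move=> sG; have VE : @measurable _ (g_sigma_algebraType G) = G.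
  exact: measurable_g_measurableTypeE.
split=> [mh _ B mB|mh _ [B mB <-]]; first by rewrite VE; apply: mh; exists B.
by rewrite -VE; exact: mh.
Qed.

Lemma bounded_wrtM G f g : sigma_algebra setT G ->
  bounded_wrt G f -> bounded_wrt G g -> bounded_wrt G (f \* g).
Proof.
move=> sG [/(measurable_wrtP _ sG) mf [M hM]] [/(measurable_wrtP _ sG) mg [N hN]].
split; first by apply/(measurable_wrtP _ sG); exact: measurable_funM.
by exists (M * N) => w; rewrite normrM ler_pM.
Qed.

Lemma bounded_wrtD G f g : sigma_algebra setT G ->
  bounded_wrt G f -> bounded_wrt G g -> bounded_wrt G (f \+ g).
Proof.
move=> sG [/(measurable_wrtP _ sG) mf [M hM]] [/(measurable_wrtP _ sG) mg [N hN]].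
split; first by apply/(measurable_wrtP _ sG); exact: measurable_funD.
by exists (M + N) => w; rewrite (le_trans (ler_normD _ _))// lerD.
Qed.

Lemma bounded_wrt_cst G c : sigma_algebra setT G -> bounded_wrt G (cst c).
Proof.
by move=> sG; split; [exact/(measurable_wrtP _ sG)|exists `|c|].
Qed.

Lemma bounded_wrtB G f g : sigma_algebra setT G ->
  bounded_wrt G f -> bounded_wrt G g -> bounded_wrt G (f \- g).
Proof.
move=> sG bf bg; have -> : f \- g = f \+ (cst (-1) \* g).
  by apply/funext => w /=; rewrite mulN1r.
by apply: bounded_wrtD => //; apply: bounded_wrtM => //; exact: bounded_wrt_cst.
Qed.

Lemma bounded_wrt_indic G B : sigma_algebra setT G -> G B ->
  bounded_wrt G \1_B.
Proof.
move=> sG GB; split.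
  apply/(measurable_wrtP _ sG); apply/measurable_indicP.
  by rewrite measurable_g_measurableTypeE.
by exists 1 => w; rewrite indicE; case: (w \in B); rewrite ?normr1 ?normr0.
Qed.

Lemma bounded_wrtS G H h : G `<=` H -> bounded_wrt G h -> bounded_wrt H h.
Proof. by move=> GH [mh bh]; split => //; exact: subset_trans GH. Qed.

Variable P : probability W R.
Local Notation I h := (Rintegral P setT h).
Local Notation bm := (bounded_wrt (@measurable d W)).

Lemma bounded_wrt_integrable h : bm h -> P.-integrable setT (EFin \o h).
Proof.
case=> mh [M hM]; apply: measurable_bounded_integrable => //.
- by rewrite (le_lt_trans (probability_le1 P measurableT))// ltry.
- by move=> _ B mB; apply: mh; exists B.
- exists M; split; first exact: num_real.
  by move=> x Mx w _; apply: le_trans (hM w) _; rewrite ltW.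
Qed.

Lemma expect_indicM B h : measurable B ->
  I (\1_B \* h) = \int[P]_(w in B) h w.
Proof.
move=> mB; rewrite [RHS]Rintegral_mkcond; apply: eq_Rintegral => w _.
by rewrite /= indicE patchE; case: (w \in B); rewrite ?mul1r ?mul0r.
Qed.

Lemma expectB f g : bm f -> bm g -> I (f \- g) = I f - I g.
Proof. by move=> bf bg; rewrite -RintegralB//; exact: bounded_wrt_integrable. Qed.

Lemma expectD f g : bm f -> bm g -> I (f \+ g) = I f + I g.
Proof. by move=> bf bg; rewrite -RintegralD//; exact: bounded_wrt_integrable. Qed.

Lemma expectZ c f : bm f -> I (cst c \* f) = c * I f.
Proof. by move=> bf; rewrite -RintegralZl//; exact: bounded_wrt_integrable. Qed.

(** The measurable sets over which [Z] integrates to zero form a Dynkin system: [p setT] gives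
    complements, and integrability gives countable disjoint unions. *)
Lemma integral_eq0_pi_system (p : set (set W)) Z :
  P.-integrable setT (EFin \o Z) -> setI_closed p -> p setT ->
  p `<=` measurable ->
  (forall B, p B -> (\int[P]_(w in B) (Z w)%:E = 0)%E) ->
  forall B, <<s p >> B -> (\int[P]_(w in B) (Z w)%:E = 0)%E.
Proof.
move=> iZ pI pT pm p0 B; rewrite -setI_closed_g_dynkin_g_sigma_algebra//.
suff : <<d p >> `<=` [set B | measurable B /\
    (\int[P]_(w in B) (Z w)%:E = 0)%E] by move=> /[apply] -[].
apply: smallest_sub; last by move=> A pA; split; [exact: pm|exact: p0].
split; first by split => //; exact: p0.
- move=> A [mA A0]; split; first exact: measurableC.
  have mZ := measurable_int P iZ.
  have := p0 _ pT; rewrite -(setUv A) integral_setU//.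
  + by rewrite A0 add0e.
  + exact: measurableC.
  + by rewrite setUv.
  + by apply/disj_setPS; rewrite setICr.
- move=> A tA hA; have mA n : measurable (A n) by have [] := hA n.
  split; first exact: bigcupT_measurable.
  rewrite integral_bigcup//; last first.
    by apply: integrableS iZ => //; exact: bigcupT_measurable.
  by rewrite eseries0// => n _ _; have [] := hA n.
Qed.

(** Repeated bisection of the range of [h] replaces approximation by simple functions: after [n]
    steps the integral is bounded by a multiple of [2 ^- n], with [n] arbitrary. *)
Lemma expect_eq0_bounded G Z : sigma_algebra setT G -> G `<=` measurable ->
  bm Z -> (forall B, G B -> I (\1_B \* Z) = 0) ->
  forall h, bounded_wrt G h -> I (h \* Z) = 0.
Proof.
move=> sG GF bZ Z0.
have bGm h : bounded_wrt G h -> bm h by exact: bounded_wrtS.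
have sM := sigma_algebra_measurable W.
have bnZ : bm (Num.norm \o Z).
  case: bZ => mZ [M hM]; split; last by exists M => w; rewrite /= normr_id.
  move/(measurable_wrtP _ sM) : mZ => mZ; apply/(measurable_wrtP _ sM).
  exact: measurableT_comp.
(* Subtracting M/2 on the event {h >= M/2} halves the range of h and leaves
   I (h \* Z) unchanged. *)
have bound n : forall M h, bounded_wrt G h -> (forall w, 0 <= h w <= M) ->
    `|I (h \* Z)| <= M / 2 ^+ n * I (Num.norm \o Z).
  elim: n => [|n IHn] M h bh hM.
    rewrite expr0 divr1; have bhZ : bm (h \* Z) by apply: bounded_wrtM => //; exact: bGm.
    rewrite (le_trans (le_normr_Rintegral _ (bounded_wrt_integrable bhZ)))//.
    rewrite -expectZ//; apply: le_Rintegral => //.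
    - exact: integrable_norm (bounded_wrt_integrable bhZ).
    - apply: bounded_wrt_integrable; apply: bounded_wrtM => //.
      exact: bounded_wrt_cst.
    - move=> w _ /=; rewrite normrM ler_wpM2r//.
      by have /andP[h0 hM'] := hM w; rewrite ger0_norm.
  pose B := [set w | M / 2 <= h w].
  have GB : G B.
    case: bh => mh _; apply: mh; exists `[M / 2, +oo[%classic => //.
    by apply/seteqP; split => w; rewrite /B /= in_itv /= andbT => -[].
  pose h' := h \- (cst (M / 2) \* \1_B).
  have bB : bounded_wrt G (cst (M / 2) \* \1_B).
    by apply: bounded_wrtM => //; [exact: bounded_wrt_cst|exact: bounded_wrt_indic].
  have bh' : bounded_wrt G h' by exact: bounded_wrtB.
  have hE : h \* Z = (cst (M / 2) \* (\1_B \* Z)) \+ (h' \* Z).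
    by apply/funext => w; rewrite /h' /=; ring.
  rewrite hE expectD; last 2 first.
  - apply: bounded_wrtM => //; first exact: bounded_wrt_cst.
    by apply: bounded_wrtM => //; apply: bGm; exact: bounded_wrt_indic.
  - by apply: bounded_wrtM => //; exact: bGm.
  rewrite expectZ; last by apply: bounded_wrtM => //; apply: bGm; exact: bounded_wrt_indic.
  rewrite Z0// mulr0 add0r exprS invfM mulrA; apply: IHn => // w.
  have /andP[h0 hM'] := hM w; rewrite /h' /= indicE /B.
  case: (boolP (w \in _)) => [/set_mem /= hw|/negP hw].
    by rewrite mulr1; lra.
  have {}hw : h w < M / 2 by rewrite ltNge; apply/negP => ?; apply: hw; exact/mem_set.
  by rewrite mulr0; lra.
have pos M h : bounded_wrt G h -> (forall w, 0 <= h w <= M) -> I (h \* Z) = 0.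
  move=> bh hM; apply/eqP; rewrite -normr_le0; apply/ler_addgt0Pl => e e0.
  rewrite addr0; set K := M * I (Num.norm \o Z).
  have [n nK] : exists n : nat, K / e < 2 ^+ n.
    exists (Num.truncn (K / e)).+1; rewrite (lt_trans (truncnS_gt _))//.
    by rewrite -natrX ltr_nat ltn_expl.
  rewrite (le_trans (bound n M h bh hM))// mulrAC -/K ler_pdivrMr ?exprn_gt0//.
  by rewrite mulrC -ler_pdivrMr// ltW.
move=> h bh; have [_ [M hM]] := bh.
have bM := bounded_wrt_cst M sG.
(* The shifted function takes values in [[0, 2M]]. The factor [\1_setT] puts the correction in the
   form to which [Z0] applies. *)
have -> : h \* Z = ((h \+ cst M) \* Z) \- (cst M \* (\1_setT \* Z)).
  by apply/funext => w /=; rewrite indicT /=; ring.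
rewrite expectB; last 2 first.
- by apply: bounded_wrtM => //; apply: bGm; exact: bounded_wrtD.
- apply: bounded_wrtM => //; first exact: bounded_wrt_cst.
  apply: bounded_wrtM => //; apply: bounded_wrt_indic => //.
have GT : G setT by case: sG => G0 GC _; rewrite -(setD0 setT); exact: GC.
rewrite expectZ; last by apply: bounded_wrtM => //; apply: bounded_wrt_indic.
rewrite Z0// mulr0 subr0; apply: (pos (M + M)); first exact: bounded_wrtD.
by move=> w /=; have := hM w; rewrite ler_norml; lra.
Qed.

(** The event [N] where [Z] exceeds [M] lies in [G], so [Z - M] and [Y - M] have the same integral
    over it. The first integrand is positive there and the second nonpositive, so [N] is
    negligible. *)
Lemma is_cond_exp_ae_le G Y Z M : sigma_algebra setT G -> G `<=` measurable ->
  P.-integrable setT (EFin \o Y) -> is_cond_exp P G Y Z ->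
  (forall w, Y w <= M) -> {ae P, forall w, Z w <= M}.
Proof.
move=> sG GF iY [mZ iZ eZ] YM; pose N := [set w | M < Z w].
have GN : G N.
  apply: mZ; exists `]M, +oo[%classic => //.
  by apply/seteqP; split => w; rewrite /N /= in_itv /= andbT => // -[].
have mN : measurable N by exact: GF.
have iM : P.-integrable setT (EFin \o cst M).
  by apply: bounded_wrt_integrable; apply: bounded_wrt_cst; exact: sigma_algebra_measurable.
have iN h : P.-integrable setT (EFin \o h) -> P.-integrable N (EFin \o h).
  exact: integrableS.
pose D := Z \- cst M.
have iZM : P.-integrable N (EFin \o D).
  have -> : EFin \o D = ((EFin \o Z) \- (EFin \o cst M))%E.
    by apply/funext => w; rewrite /= EFinB.
  exact: integrableB (iN _ iZ) (iN _ iM).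
have int0 : (\int[P]_(w in N) `|(EFin \o D) w| = 0)%E.
  rewrite -[LHS]fineK; last by exact: integrable_fin_num (integrable_abse iZM).
  congr EFin; apply/eqP; rewrite eq_le.
  rewrite [X in _ && X]fine_ge0 ?integral_ge0// andbT.
  have -> : fine (\int[P]_(w in N) `|(EFin \o D) w|)%E =
      \int[P]_(w in N) (Z w - M).
    apply: eq_Rintegral => w /set_mem Nw.
    by rewrite /= ger0_norm// subr_ge0 ltW.
  rewrite (RintegralB mN (iN _ iZ) (iN _ iM)) {1}/Rintegral (eZ _ GN) subr_le0.
  by apply: le_Rintegral; [exact: mN|exact: iN|exact: iN|].
have /(ae_eq_integral_abs P mN) := measurable_int P iZM.
move=> /iffLR /(_ int0); apply: filterS => w /= hw.
rewrite leNgt; apply/negP => Nw.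
by have /eqP := hw Nw; rewrite eqe subr_eq0 gt_eqF.
Qed.

(* A bounded version can be tested against all bounded G-measurable functions,
   so that the pull-out property becomes associativity of multiplication. *)
Definition is_bounded_cond_exp G Y Z :=
  bounded_wrt G Z /\ forall h, bounded_wrt G h -> I (h \* Y) = I (h \* Z).

Lemma expect_bounded_ext G Y Z : sigma_algebra setT G -> G `<=` measurable ->
  bm Y -> bm Z ->
  (forall B, G B -> \int[P]_(w in B) (Z w)%:E = \int[P]_(w in B) (Y w)%:E)%E ->
  forall h, bounded_wrt G h -> I (h \* Y) = I (h \* Z).
Proof.
move=> sG GF bY bZ YZ h bh; have sM := sigma_algebra_measurable W.
have bhm : bm h by exact: bounded_wrtS bh.
apply/eqP; rewrite -subr_eq0 -expectB; [|exact: bounded_wrtM..].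
have -> : h \* Y \- h \* Z = h \* (Y \- Z).
  by apply/funext => w /=; rewrite mulrBr.
apply/eqP; apply: (expect_eq0_bounded sG GF) => //; first exact: bounded_wrtB.
move=> B GB; have mB := GF _ GB; rewrite expect_indicM// RintegralB//.
- by rewrite /Rintegral YZ// subrr.
- by apply: integrableS (bounded_wrt_integrable bY).
- by apply: integrableS (bounded_wrt_integrable bZ).
Qed.

Lemma expect_bounded_ext_pi_system (p : set (set W)) Y Z :
  setI_closed p -> p setT -> p `<=` measurable -> bm Y -> bm Z ->
  (forall B, p B -> I (\1_B \* Y) = I (\1_B \* Z)) ->
  forall h, bounded_wrt <<s p >> h -> I (h \* Y) = I (h \* Z).
Proof.
move=> pI pT pm bY bZ YZ; have sM := sigma_algebra_measurable W.
have intB h B : bm h -> measurable B -> P.-integrable B (EFin \o h).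
  by move=> /bounded_wrt_integrable ih mB; exact: integrableS ih.
have sp : <<s p >> `<=` measurable by exact: smallest_sub.
apply: expect_bounded_ext => // B pB.
have mB := sp _ pB; have bYZ := bounded_wrtB sM bZ bY.
suff : \int[P]_(w in B) (Z \- Y) w = 0.
  rewrite RintegralB//; [|exact: intB..] => /eqP; rewrite subr_eq0 => /eqP ZY.
  (* Both integrals are finite, so the equality [ZY] of their [fine] values lifts to the extended
     reals. *)
  rewrite -[LHS]fineK -1?[RHS]fineK; first by congr EFin.
  - by rewrite integrable_fin_num//; exact: intB.
  - by rewrite integrable_fin_num//; exact: intB.
rewrite /Rintegral.
rewrite (integral_eq0_pi_system (p := p))//; first exact: bounded_wrt_integrable.
move=> A pA; have mA := pm _ pA.
rewrite -[LHS]fineK ?integrable_fin_num//; last exact: intB.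
congr EFin; rewrite -[LHS]/(Rintegral _ _ _) RintegralB//; [|exact: intB..].
by rewrite -!(expect_indicM _ mA) YZ// subrr.
Qed.

Lemma is_bounded_cond_expP G Y Z : sigma_algebra setT G -> G `<=` measurable ->
  bm Y -> is_bounded_cond_exp G Y Z -> is_cond_exp P G Y Z.
Proof.
move=> sG GF bY [bZ YZ]; have bZm : bm Z by exact: bounded_wrtS bZ.
split; [by case: bZ|exact: bounded_wrt_integrable|move=> B GB].
have mB := GF _ GB; have := YZ _ (bounded_wrt_indic sG GB).
rewrite !expect_indicM// => YZB; rewrite -[LHS]fineK -1?[RHS]fineK.
- by congr EFin; rewrite -[LHS]/(Rintegral _ _ _) -YZB.
- by apply: integrable_fin_num => //; apply: integrableS (bounded_wrt_integrable bY).
- by apply: integrable_fin_num => //; apply: integrableS (bounded_wrt_integrable bZm).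
Qed.

(** Any version is almost surely between [- M] and [M] when [Y] is, so clamping it to that interval
    yields an everywhere bounded function and changes it only on a negligible set. *)
Lemma is_bounded_cond_exp_exists G Y :
  sigma_algebra setT G -> G `<=` measurable -> bm Y ->
  exists Z, is_bounded_cond_exp G Y Z.
Proof.
move=> sG GF bY; have iY := bounded_wrt_integrable bY.
have sM := sigma_algebra_measurable W.
have [Z hZ] := is_cond_exp_exists sG GF iY.
have [mY [M hM]] := bY.
pose Z' w := Num.max (- M) (Num.min M (Z w)).
have mZ : measurable_fun [set: g_sigma_algebraType G] (Z : g_sigma_algebraType G -> R).
  by apply/(measurable_wrtP _ sG); case: hZ.
have bZ' : bounded_wrt G Z'.
  split.
    apply/(measurable_wrtP _ sG).
    by apply: measurable_maxr => //; exact: measurable_minr.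
  exists M => w; rewrite /Z' ler_norml le_max lexx/= ge_max ge_min lexx andbT.
  by rewrite ge0_cp// (le_trans _ (hM w)).
have bZ'm : bm Z' by exact: bounded_wrtS bZ'.
have leM : {ae P, forall w, Z w <= M}.
  apply: (is_cond_exp_ae_le sG GF iY hZ) => w.
  by rewrite (le_trans (ler_norm _)).
(* The lower bound is the upper bound for [\- Y], of which [\- Z] is a version. *)
have geM : {ae P, forall w, - Z w <= M}.
  apply: (@is_cond_exp_ae_le G (\- Y) (\- Z) M sG GF).
  - have bN : bm (cst (-1) \* Y).
      by apply: bounded_wrtM => //; exact: bounded_wrt_cst.
    have -> : \- Y = cst (-1) \* Y by apply/funext => w /=; rewrite mulN1r.
    exact: bounded_wrt_integrable.
  - case: hZ => _ iZ eZ; split.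
    + by apply/(measurable_wrtP _ sG); exact: measurableT_comp.
    + exact: integrableN iZ.
    + move=> B GB; have mB := GF _ GB.
      have intN h : P.-integrable setT (EFin \o h) ->
          (\int[P]_(w in B) ((\- h) w)%:E = - \int[P]_(w in B) (h w)%:E)%E.
        move=> ih; rewrite -integralN//=.
        by apply: integrable_add_def => //; exact: integrableS ih.
      by rewrite !intN// eZ.
  - by move=> w; rewrite (le_trans _ (hM w))// -normrN ler_norm.
have ZZ' : Z = Z' %[ae P].
  apply: filterS2 leM geM => w h1 h2 _.
  by rewrite /Z' min_r// max_r// lerNl.
exists Z'; split => //; apply: expect_bounded_ext => // B GB.
case: hZ => _ iZ <-//; apply: ae_eq_integral => //.
- exact: GF.
- by apply: measurable_funS (measurable_int P (bounded_wrt_integrable bZ'm)).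
- by apply: measurable_funS (measurable_int P iZ).
- by apply: filterS ZZ' => w /= h _; rewrite h.
Qed.

Lemma ae_eq_cond_exp G Y Z : sigma_algebra setT G -> G `<=` measurable ->
  bm Y -> is_bounded_cond_exp G Y Z -> cond_exp P G Y = Z %[ae P].
Proof.
move=> sG GF bY /(is_bounded_cond_expP sG GF bY) hZ.
by apply: is_cond_exp_unique hZ => //; apply: cond_expP => //; exact: bounded_wrt_integrable.
Qed.

Lemma expectC f g : I (f \* g) = I (g \* f).
Proof. by congr Rintegral; apply/funext => w /=; rewrite mulrC. Qed.

(** Self-adjointness: both sides equal the expectation of [Z \* Z']. *)
Lemma expect_cond_exp_sym G Y Z Y' Z' : is_bounded_cond_exp G Y Z ->
  is_bounded_cond_exp G Y' Z' -> I (Z \* Y') = I (Y \* Z').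
Proof. by case=> bZ eY [bZ' eY']; rewrite eY'// expectC -eY// expectC. Qed.

Lemma is_bounded_cond_exp_trans G H Y Z Z' : H `<=` G ->
  is_bounded_cond_exp G Y Z -> is_bounded_cond_exp H Z Z' ->
  is_bounded_cond_exp H Y Z'.
Proof.
move=> HG [_ eY] [bZ' eZ]; split=> // h bh.
by rewrite eY ?eZ//; exact: bounded_wrtS bh.
Qed.

End bounded_conditional_expectation.

(** * Finite families of sets and their intersections *)

Section set_families.
Context {R : realType} {T : metricType R}.
Implicit Types (A B C V : set T) (D S : set (set T)).

Lemma finite_exists_maximal D A : finite_set D -> D A ->
  exists B, [/\ D B, A `<=` B & forall B', D B' -> B `<=` B' -> B' = B].
Proof.
move=> /finite_seqP[s ->]; elim: s A => [//|C s IHs] A /= sA.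
have [[A' sA' AA']|nA] := pselect (exists2 A', A' \in s & A `<=` A').
  have [B [sB AB maxB]] := IHs _ sA'.
  (* Only the new head [C] can destroy the maximality of [B]; in that case [C] is itself maximal and
     replaces [B]. *)
  have [[BC nCB]|nBC] := pselect (B `<=` C /\ C <> B); last first.
    exists B; split; [by rewrite /= inE sB orbT|exact: subset_trans AB|].
    move=> B' /=; rewrite inE => /predU1P[->|sB'] BB'; last exact: maxB.
    by apply: contrapT => nC; apply: nBC.
  exists C; split; [by rewrite /= mem_head|by apply: subset_trans BC; apply: subset_trans AB|].
  move=> B' /=; rewrite inE => /predU1P[//|sB'] CB'.
  have B'E := maxB _ sB' (subset_trans BC CB').
  by apply/seteqP; split => //; rewrite B'E.
move: sA; rewrite inE => /predU1P[AC|sA]; last by case: nA; exists A.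
exists A; split => //; first by rewrite /= AC mem_head.
move=> B' /=; rewrite inE => /predU1P[->//|sB'] AB'.
by case: nA; exists B'.
Qed.

(** Arbitrary nonempty subfamilies rather than pairs, because the members of [calA_C] are given as
    such intersections. *)
Definition meets_closed S :=
  forall S0, S0 !=set0 -> S0 `<=` S -> S (\bigcap_(A in S0) A).

Lemma meets_closedI S A B : meets_closed S -> S A -> S B -> S (A `&` B).
Proof.
move=> Scl SA SB; have -> : A `&` B = \bigcap_(C in [set A; B]) C.
  by rewrite bigcap_setU !bigcap_set1.
by apply: Scl => [|C [->|->]//]; exists A; left.
Qed.

(* Defs.meets is qualified because topology has another [meets]. *)
Lemma meets_closed_meets D : meets_closed (Defs.meets D).
Proof.
move=> S0 [A S0A] S0D.
(* Taking every member of [D] that contains the intersection avoids choosing a subfamily of [D] for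
   each member of [S0]. *)
pose S1 := [set B | D B /\ \bigcap_(A in S0) A `<=` B].
exists S1; split.
- have [S [[B SB] SD AE]] := S0D _ S0A.
  exists B; split; first exact: SD.
  by move=> t /(_ _ S0A); rewrite AE; exact.
- by move=> B [].
- apply/seteqP; split=> [t St B [_]|t St B S0B]; first exact.
  have [S [_ SD BE]] := S0D _ S0B; rewrite BE => C SC; apply: St; split.
    exact: SD.
  by apply: subset_trans (bigcap_inf S0B) _; rewrite BE; exact: bigcap_inf.
Qed.

Lemma sub_meets D : D `<=` Defs.meets D.
Proof.
move=> A DA; exists [set A]; split; [by exists A| |by rewrite bigcap_set1].
by move=> _ ->.
Qed.

Lemma meetsS D D' : D `<=` D' -> Defs.meets D `<=` Defs.meets D'.
Proof.
by move=> DD' _ [S [S0 SD ->]]; exists S; split => //; exact: subset_trans DD'.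
Qed.

Lemma finite_meets D : finite_set D -> finite_set (Defs.meets D).
Proof.
move=> /finite_seqP[s ->].
(* A subfamily of [D] is encoded by a boolean mask on a list enumerating [D], and there are finitely
   many masks. *)
pose cap (m : (size s).-tuple bool) := \bigcap_(A in [set` mask m s]) A.
apply: sub_finite_set (finite_image cap (@finite_finset _ setT)).
move=> _ [S [_ Ss ->]]; exists [tuple of map (fun A => `[< S A >]) (in_tuple s)] => //.
rewrite /cap /= -filter_mask; congr (\bigcap_(A in _) A).
apply/seteqP; split=> A /=; rewrite mem_filter; first by case/andP => /asboolP.
by move=> SA; rewrite (Ss _ SA) andbT; exact/asboolP.
Qed.

End set_families.

(** * Building increments from the Shape property *)

Section increments.
Context {R : realType} {T : metricType R} {calA : set (set T)}.
Hypothesis hA : indexing_collection calA.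

(** The maximal members of [S] inside [A] form an antichain [D], hence an extremal representation.
    For [B] in [S], the set [A] meets [B] in a member of [S], which lies below a member of [D], so
    [B] misses [C]. Were [C] empty, Shape would put [A] inside a member of [D], contrary to
    hypothesis. *)
Lemma exists_increment (S : set (set T)) (A : set T) :
  finite_set S -> S !=set0 -> S `<=` calA -> meets_closed S -> calA A ->
  (forall B, S B -> ~ (A `<=` B)) -> (forall B, S B -> S (A `&` B)) ->
  exists C D, [/\ increment_rep calA C A D, C !=set0, calA_C D `<=` S &
    forall B, S B -> B `&` C = set0].
Proof.
move=> fS [B0 SB0] SA Scl AA nA SI.
pose SsubA := [set B | S B /\ B `<=` A].
have fSA : finite_set SsubA by apply: sub_finite_set fS => B [].
pose D := [set B | SsubA B /\ forall B', SsubA B' -> B `<=` B' -> B' = B].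
have DS : D `<=` S by move=> B [[]].
have DA : D `<=` calA by exact: subset_trans SA.
have coverD B : S B -> exists2 B', D B' & A `&` B `<=` B'.
  move=> SB; have [|B' [SB' BB' maxB']] := @finite_exists_maximal _ _ _ (A `&` B) fSA.
    by split; [exact: SI|exact: subIsetl].
  by exists B'.
have D0 : D !=set0 by have [B' DB' _] := coverD _ SB0; exists B'.
have fD : finite_set D by apply: sub_finite_set fS.
exists (A `\` \bigcup_(B in D) B), D; split.
- split=> //; last by move=> t [B [[_ BA] _] Bt]; exact: BA.
  by move=> A1 A2 [_ max1] [S2 _] A12 /(max1 _ S2) /esym.
- apply/set0P/negP => /eqP; rewrite setD_eq0 => Asub.
  have [B DB AB] := idx_shape hA AA fD D0 DA Asub.
  exact: nA (DS _ DB) AB.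
- move=> U [[S0 [S00 S0D ->]] _]; apply: Scl => //.
  exact: subset_trans DS.
- move=> B SB; rewrite -subset0 => t [Bt [At]]; apply.
  by have [B' DB' BB'] := coverD _ SB; exists B' => //; exact: BB'.
Qed.

End increments.

(** * The C-Markov property and conditional independence *)

Section markov.
Context {R : realType} {T E : metricType R} {calA : set (set T)}.
Context {d} {W : measurableType d} {P : probability W R}.
Variables (F : set T -> set (set W)) (X : set T -> W -> E).
Hypothesis hA : indexing_collection calA.
Hypothesis hF : complete_filtration calA P F.
Hypothesis hX : C_Markov calA P F X.
Implicit Types (A B C U V : set T) (D S : set (set T)).
Local Notation I h := (Rintegral P setT h).

Lemma sigma_algebra_sigma_X S : sigma_algebra setT (sigma_X X S).
Proof. exact: smallest_sigma_algebra. Qed.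

Lemma sigma_X_sub S (G : set (set W)) : sigma_algebra setT G ->
  (forall A, S A -> measurable_wrt G (@borel E) (X A)) -> sigma_X X S `<=` G.
Proof.
by move=> sG hG; apply: smallest_sub => // Q [A SA]; exact: hG.
Qed.

Lemma sigma_X_preimage S A : S A ->
  measurable_wrt (sigma_X X S) (@borel E) (X A).
Proof. by move=> SA Q hQ; apply: sub_sigma_algebra; exists A. Qed.

Lemma sigma_XS S S' : S `<=` S' -> sigma_X X S `<=` sigma_X X S'.
Proof.
move=> SS'; apply: sigma_X_sub; first exact: sigma_algebra_sigma_X.
by move=> A /SS'; exact: sigma_X_preimage.
Qed.

Lemma sigma_X_measurable S : S `<=` calA -> sigma_X X S `<=` measurable.
Proof.
move=> SA; apply: sigma_X_sub; first exact: sigma_algebra_measurable.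
by move=> A /SA cA; apply: subset_trans (filt_sub hF cA); exact: hX.1.
Qed.

Lemma sigma_X_filt S V : S `<=` calA -> calA V -> (forall A, S A -> A `<=` V) ->
  sigma_X X S `<=` F V.
Proof.
move=> SA cV SV; apply: sigma_X_sub; first exact: (filt_sigma hF).
move=> A SA'; have cA := SA _ SA'.
apply: subset_trans (filt_mono hF cA cV (SV _ SA')); exact: hX.1.
Qed.

Lemma filt_star_sub C A : calA A -> A `&` C = set0 ->
  F A `<=` filt_star calA F C.
Proof.
move=> cA AC Q FQ; apply: sub_sigma_algebra; exists A.
  split => //; exists [set A]; split; [exact: finite_set1|by exists A| |].
    by move=> _ ->.
  by rewrite bigcup_set1.
by apply: sub_sigma_algebra; exists A => //; split.
Qed.

Lemma filt_star_measurable C : filt_star calA F C `<=` measurable.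
Proof.
apply: smallest_sub; first exact: sigma_algebra_measurable.
move=> Q [B _]; apply: smallest_sub; first exact: sigma_algebra_measurable.
by move=> {}Q [A [cA _]]; exact: (filt_sub hF).
Qed.

Lemma measurable_wrt_indic_borel (K : set E) : borel K ->
  measurable_wrt (@borel E) (@measurable _ R) (\1_K : E -> R).
Proof.
move=> bK; have [b0 bC _] : sigma_algebra setT (@borel E).
  exact: smallest_sigma_algebra.
have bT : borel [set: E] by rewrite -[setT]setD0; exact: bC.
move=> _ [B mB <-]; rewrite setTI preimage_indic.
do 2 case: ifP => _ //; rewrite -setTD; exact: bC.
Qed.

(** The C-Markov property for the indicator of [K], in weak form: a bounded version [f] given [X_C]
    can replace the indicator of an event on [X A] under any bounded test function of the past. *)
Lemma C_Markov_expect C A D (K : set E) : increment_rep calA C A D ->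
  C !=set0 -> calA_C D `<=` calA -> borel K ->
  exists2 f, bounded_wrt (sigma_X X (calA_C D)) f &
    forall g, bounded_wrt (filt_star calA F C) g ->
      I (g \* \1_(X A @^-1` K)) = I (g \* f).
Proof.
move=> CAD C0 DA bK; have cA := inc_A CAD.
pose N := X A @^-1` K.
have mN : measurable N.
  by apply: (filt_sub hF cA); apply: (hX.1 _ cA); exists K => //; rewrite setTI.
have sM := sigma_algebra_measurable W.
have bN : bounded_wrt (@measurable d W) (\1_N : W -> R) by exact: bounded_wrt_indic.
have sS : sigma_algebra setT (filt_star calA F C) by exact: smallest_sigma_algebra.
have sX := sigma_algebra_sigma_X (calA_C D).
have mX := sigma_X_measurable DA.
have mS := @filt_star_measurable C.
have [f hf] := is_bounded_cond_exp_exists P sX mX bN.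
exists f; first by case: hf.
have bfm : bounded_wrt (@measurable d W) f by apply: bounded_wrtS hf.1.
apply: expect_bounded_ext => // B GB; have mB := mS _ GB.
have [_ iZ <-//] := cond_expP sS mS (bounded_wrt_integrable P bN).
have NE : \1_N = (\1_K : E -> R) \o X A.
  apply/funext => w; rewrite /= !indicE.
  by congr (_%:R); apply/idP/idP => /set_mem Kw; exact/mem_set.
have := ae_eq_cond_exp sX mX bN hf.
have : cond_exp P (filt_star calA F C) \1_N = cond_exp P (sigma_X X (calA_C D)) \1_N %[ae P].
  rewrite NE; apply: hX.2 => //; first exact: measurable_wrt_indic_borel.
  exists 1; split => // x x1 t _; rewrite /= indicE.
  by case: (t \in K); rewrite ?normr1 ?normr0 ltW// (lt_trans _ x1).
move=> e1 e2; apply: ae_eq_integral => //.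
- by apply: measurable_funS (measurable_int P (bounded_wrt_integrable P bfm)).
- by apply: measurable_funS (measurable_int P iZ).
- by apply: filterS2 e1 e2 => w h1 h2 _; rewrite h1// h2.
Qed.

(** For [G] in [sigma_X X S] and an event [N] on [X A], the C-Markov property replaces [\1_N] by
    some [f] measurable for [sigma_X X S]. Then [b] can be replaced by [Z], and [f] is turned back
    into [\1_N], because [Z] too is measurable for [filt_star]. *)
Lemma is_bounded_cond_exp_add S C A D b Z : increment_rep calA C A D ->
  C !=set0 -> calA_C D `<=` S -> S `<=` calA ->
  (forall B, S B -> B `&` C = set0) ->
  bounded_wrt (filt_star calA F C) b ->
  is_bounded_cond_exp P (sigma_X X S) b Z ->
  is_bounded_cond_exp P (sigma_X X (A |` S)) b Z.
Proof.
move=> CAD C0 DS SA SC bb [bZ hZ]; have cA := inc_A CAD.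
have sS := sigma_algebra_sigma_X S.
have SF : sigma_X X S `<=` filt_star calA F C.
  apply: sigma_X_sub; first exact: smallest_sigma_algebra.
  move=> B SB; apply: subset_trans (filt_star_sub (SA _ SB) (SC _ SB)).
  exact: hX.1 (SA _ SB).
have mS := sigma_X_measurable SA.
have mF := @filt_star_measurable C.
pose p := [set Q | exists G K, [/\ sigma_X X S G, borel K & Q = G `&` X A @^-1` K]].
have sB : sigma_algebra setT (@borel E) by exact: smallest_sigma_algebra.
have [ST _ _ SI] : [/\ sigma_X X S setT, setSD_closed (sigma_X X S),
  ndseq_closed (sigma_X X S) & setI_closed (sigma_X X S)] by exact/sigma_algebraP.
have [bT _ _ bI] : [/\ borel [set: E], setSD_closed (@borel E),
  ndseq_closed (@borel E) & setI_closed (@borel E)] by exact/sigma_algebraP.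
have pX : sigma_X X (A |` S) `<=` <<s p >>.
  apply: sigma_X_sub; first exact: smallest_sigma_algebra.
  move=> B [->|SB] _ [K bK <-]; rewrite setTI; apply: sub_sigma_algebra.
    by exists setT, K; rewrite setTI.
  exists (X B @^-1` K), setT; split => //; last by rewrite preimage_setT setIT.
  by apply: (sigma_X_preimage SB); exists K => //; rewrite setTI.
have mA K : borel K -> measurable (X A @^-1` K).
  move=> bK; apply: (filt_sub hF cA); apply: (hX.1 _ cA).
  by exists K => //; rewrite setTI.
split; first by apply: bounded_wrtS bZ; apply: sigma_XS => B; right.
move=> h bh; have {}bh := bounded_wrtS pX bh; move: h bh.
have bM := bounded_wrtS mF bb.
have bZM := bounded_wrtS mS bZ.
apply: expect_bounded_ext_pi_system => //.
- move=> _ _ [G1 [K1 [hG1 hK1 ->]]] [G2 [K2 [hG2 hK2 ->]]].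
  exists (G1 `&` G2), (K1 `&` K2); split; [exact: SI|exact: bI|by rewrite preimage_setI setIACA].
- by exists setT, setT; rewrite preimage_setT setIT.
- by move=> _ [G [K [hG hK ->]]]; apply: measurableI; [exact: mS|exact: mA].
move=> _ [G [K [GS bK ->]]].
have [f bf hf] := C_Markov_expect CAD C0 (subset_trans DS SA) bK.
have {}bf : bounded_wrt (sigma_X X S) f by apply: bounded_wrtS bf; exact: sigma_XS.
have bG : bounded_wrt (sigma_X X S) (\1_G : W -> R) by exact: bounded_wrt_indic.
set N := X A @^-1` K.
have sF : sigma_algebra setT (filt_star calA F C) by exact: smallest_sigma_algebra.
transitivity (I ((\1_G \* b) \* \1_N)).
  by congr Rintegral; apply/funext => w; rewrite indicI /=; ring.
rewrite hf; last by apply: bounded_wrtM => //; exact: bounded_wrtS bG.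
transitivity (I ((\1_G \* f) \* b)).
  by congr Rintegral; apply/funext => w /=; ring.
rewrite hZ; last exact: bounded_wrtM.
transitivity (I ((\1_G \* Z) \* f)).
  by congr Rintegral; apply/funext => w /=; ring.
rewrite -hf; last by apply: bounded_wrtS SF _; exact: bounded_wrtM.
by congr Rintegral; apply/funext => w; rewrite indicI /=; ring.
Qed.

(** Induction on the number of sets: one set not included in [V] is removed at a time, down to the
    hypothesis on the sets included in [V]. *)
Lemma is_bounded_cond_exp_meets S V b Z : finite_set S -> S `<=` calA ->
  meets_closed S -> calA V -> (forall A, S A -> S (A `&` V)) ->
  bounded_wrt (F V) b ->
  is_bounded_cond_exp P (sigma_X X [set A | S A /\ A `<=` V]) b Z ->
  is_bounded_cond_exp P (sigma_X X S) b Z.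
Proof.
move=> /finite_seqP[s SE] + + cV + bb.
have [n] := ubnP (size s); elim: n s S SE => // n IHn s S SE sn SA Scl SV hZ.
have [SsubV|] := pselect (S `<=` [set A | A `<=` V]).
  suff -> : S = [set A | S A /\ A `<=` V] by [].
  by apply/seteqP; split => A; [move=> SA'; split => //; exact: SsubV|case].
move=> /existsNP[A0 /not_implyP[SA0 nA0V]].
have fS : finite_set S by apply/finite_seqP; exists s.
(* Maximality makes [A] removable: an intersection of members of [S] other than [A] is never [A], so
   the remaining family is still closed. *)
have [A [SA' A0A maxA]] := finite_exists_maximal fS SA0.
have nAV : ~ A `<=` V by move=> AV; apply: nA0V; exact: subset_trans AV.
pose S' := S `\ A.
have S'S : S' `<=` S by move=> B [].
have nAS' B : S' B -> ~ A `<=` B by move=> [SB nBA] /(maxA _ SB).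
have S'AI B : S B -> ~ A `<=` B -> S' (A `&` B).
  move=> SB nAB; split; first exact: meets_closedI.
  by move=> /= ABA; apply: nAB; rewrite -ABA; exact: subIsetr.
have S'AV : S' (A `&` V).
  split; first exact: SV.
  by move=> /= AVA; apply: nAV; rewrite -AVA; exact: subIsetr.
have S'A : S' `<=` calA by exact: subset_trans SA.
have S'cl : meets_closed S'.
  move=> S0 S00 S0S'; split; first by apply: Scl => //; exact: subset_trans S'S.
  move=> /= S0A; have [B S0B] := S00.
  by apply: (nAS' _ (S0S' _ S0B)); rewrite -S0A; exact: bigcap_inf.
have [|||C [D [CAD C0 DS' S'C]]] := exists_increment hA _ _ S'A S'cl (SA _ SA') nAS' _.
- exact: sub_finite_set fS.
- by exists (A `&` V).
- by move=> B S'B; apply: S'AI; [exact: S'S|exact: nAS'].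
(* It remains to see that [V] misses [C]. As [C] is part of [A], any common point would lie in the
   intersection of [A] and [V], a member of [S'] and so disjoint from [C]. *)
rewrite -(setD1K SA'); apply: (is_bounded_cond_exp_add CAD) => //.
  apply: bounded_wrtS bb; apply: filt_star_sub => //.
  rewrite -(S'C _ S'AV); apply/seteqP; split => t [].
    by move=> Vt Ct; split=> //; split=> //; move: Ct; rewrite (inc_eq CAD) => -[].
  by move=> [_ Vt].
apply: (IHn [seq B <- s | B != A]) => //.
- apply/seteqP; split => B /=; rewrite mem_filter /=.
    by rewrite /S' SE => -[/= -> nBA]; rewrite andbT; exact/eqP.
  by move=> /andP[/eqP nBA sB]; split; rewrite // SE.
- rewrite size_filter; apply: leq_trans (_ : size s <= n)%N; last by rewrite -ltnS.
  (* The length of [s] is the number of occurrences of [A], at least one, plus the length of the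
     filtered list. *)
  rewrite -(count_predC (pred1 A) s) -[X in (X < _)%N]add0n ltn_add2r.
  by rewrite -has_count has_pred1; move: SA'; rewrite SE.
- move=> B [SB nBA]; split; first exact: SV.
  by move=> /= BVA; apply: nAV; rewrite -BVA; exact: subIsetr.
- suff -> : [set B | S' B /\ B `<=` V] = [set B | S B /\ B `<=` V] by [].
  apply/seteqP; split => B [SB BV]; split=> //; first exact: S'S.
  by split => //= BA; apply: nAV; rewrite -BA.
Qed.

(* The previous lemma with F_V and sigma_X X S exchanged: conditional
   independence is symmetric. *)
Lemma is_bounded_cond_exp_filt S V q r : finite_set S -> S `<=` calA ->
  meets_closed S -> calA V -> (forall A, S A -> S (A `&` V)) ->
  bounded_wrt (sigma_X X S) q ->
  is_bounded_cond_exp P (sigma_X X [set A | S A /\ A `<=` V]) q r ->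
  is_bounded_cond_exp P (F V) q r.
Proof.
move=> fS SA Scl cV SV bq hr.
set SubV := [set A | _] in hr.
have VA : SubV `<=` calA by move=> A [/SA].
split.
  by apply: bounded_wrtS hr.1; apply: sigma_X_filt => // A [].
move=> b bb.
have bbM : bounded_wrt (@measurable d W) b by apply: bounded_wrtS bb; exact: (filt_sub hF).
have [b' hb'] := is_bounded_cond_exp_exists P (sigma_algebra_sigma_X SubV)
  (sigma_X_measurable VA) bbM.
have [_ hbS] := is_bounded_cond_exp_meets fS SA Scl cV SV bb hb'.
by rewrite expectC hbS// expectC (expect_cond_exp_sym hb' hr).
Qed.

(** Self-adjointness moves the conditioning from [y] to the test function [g]. The claim then
    compares two fixed bounded variables, [gV] and [gI], against [y], so it can be checked on
    indicators from a pi-system. *)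
Lemma is_bounded_cond_exp_filtI U V y yV yI : calA U -> calA V ->
  calA (U `&` V) -> bounded_wrt (sigma_X X calA) y ->
  is_bounded_cond_exp P (F V) y yV ->
  is_bounded_cond_exp P (F (U `&` V)) y yI ->
  is_bounded_cond_exp P (F U) yV yI.
Proof.
move=> cU cV cI bY hV hI; split.
  by apply: bounded_wrtS hI.1; apply: filt_mono hF _ _ cI cU _; exact: subIsetl.
move=> g bg.
have bgM : bounded_wrt (@measurable d W) g by apply: bounded_wrtS bg; exact: (filt_sub hF).
have [gV hgV] := is_bounded_cond_exp_exists P (filt_sigma hF cV) (filt_sub hF cV) bgM.
have [gI hgI] := is_bounded_cond_exp_exists P (filt_sigma hF cI) (filt_sub hF cI) bgM.
rewrite -(expect_cond_exp_sym hgV hV) -(expect_cond_exp_sym hgI hI) expectC [RHS]expectC.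
(* Requiring [U] and [V] in [D] makes the family of meets stable under intersection with either.
   Taking unions of the families [D] shows that [p] is a pi-system. *)
pose p := [set Q | exists D, [/\ finite_set D, D `<=` calA, D U, D V &
  sigma_X X (Defs.meets D) Q]].
have meetsA D : D `<=` calA -> Defs.meets D `<=` calA.
  by move=> DA _ [S [S0 SD ->]]; apply: idx_bigcap => //; exact: subset_trans DA.
have Xp : sigma_X X calA `<=` <<s p >>.
  apply: sigma_X_sub; first exact: smallest_sigma_algebra.
  move=> A cA Q hQ; apply: sub_sigma_algebra; exists [set A; U; V]; split.
  - exact: finite_set3.
  - by move=> B [[->|->]|->].
  - by left; right.
  - by right.
  - by apply: sigma_X_preimage hQ; apply: sub_meets; left; left.
have {bY}bY : bounded_wrt <<s p >> y by exact: bounded_wrtS bY.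
move: y bY {hV hI}; apply: expect_bounded_ext_pi_system => //.
- move=> Q1 Q2 [D1 [f1 A1 U1 V1 h1]] [D2 [f2 A2 U2 V2 h2]].
  have sX := sigma_algebra_sigma_X (Defs.meets (D1 `|` D2)).
  have [_ _ _ sI] := iffLR (sigma_algebraP (fun _ _ => @subsetT _ _)) sX.
  exists (D1 `|` D2); split; rewrite ?finite_setU//; [by move=> B []; auto|by left|by left|].
  by apply: sI; [apply: sigma_XS h1|apply: sigma_XS h2]; apply: meetsS => B; [left|right].
- exists [set U; V]; split; [exact: finite_set2|by move=> B [->|->]|by left|by right|].
  by have [] := iffLR (sigma_algebraP (fun _ _ => @subsetT _ _)) (sigma_algebra_sigma_X (Defs.meets [set U; V])).
- by move=> Q [D [_ DA _ _]]; apply: sigma_X_measurable; exact: meetsA.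
- by apply: bounded_wrtS hgV.1; exact: (filt_sub hF).
- by apply: bounded_wrtS hgI.1; exact: (filt_sub hF).
move=> Q [D [fD DA DU DV hQ]].
pose S := Defs.meets D.
have SA : S `<=` calA by exact: meetsA.
have fS : finite_set S by exact: finite_meets.
have Scl : meets_closed S by exact: meets_closed_meets.
have SU : S U by exact: sub_meets.
have SV : S V by exact: sub_meets.
pose SsubV := [set A | S A /\ A `<=` V].
have subVS : SsubV `<=` S by move=> A [].
have subVA : SsubV `<=` calA by exact: subset_trans SA.
have fSV : finite_set SsubV by exact: sub_finite_set fS.
have SVcl : meets_closed SsubV.
  move=> S0 S00 S0V; split; first by apply: Scl => //; exact: subset_trans subVS.
  have [B S0B] := S00; apply: subset_trans (S0V _ S0B).2; exact: bigcap_inf.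
pose SsubI := [set A | SsubV A /\ A `<=` U].
have SIE : SsubI = [set A | S A /\ A `<=` U `&` V].
  apply/seteqP; split=> A.
    by move=> [[SA' AV] AU]; split=> // t At; split; [exact: AU|exact: AV].
  by move=> [SA']; rewrite subsetI => -[AU AV].
have subIA : SsubI `<=` calA by move=> A [/subVA].
have bq : bounded_wrt (sigma_X X S) (\1_Q : W -> R).
  by apply: bounded_wrt_indic => //; exact: sigma_algebra_sigma_X.
have bqM := bounded_wrtS (sigma_X_measurable SA) bq.
(* Two successive projections on finitely generated sigma-fields: [q1] represents conditioning on
   [F V], and [q2] conditioning [q1] on [F U]. By the tower property [q2] also represents
   conditioning [\1_Q] on the intersection. *)
have [q1 hq1] := is_bounded_cond_exp_exists P (sigma_algebra_sigma_X SsubV)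
  (sigma_X_measurable subVA) bqM.
have bq1M := bounded_wrtS (sigma_X_measurable subVA) hq1.1.
have [q2 hq2] := is_bounded_cond_exp_exists P (sigma_algebra_sigma_X SsubI)
  (sigma_X_measurable subIA) bq1M.
have qV : is_bounded_cond_exp P (F V) \1_Q q1.
  by apply: is_bounded_cond_exp_filt hq1 => // A SA'; exact: meets_closedI.
have qU : is_bounded_cond_exp P (F U) q1 q2.
  apply: is_bounded_cond_exp_filt hq2 => //; last exact: hq1.1.
  move=> A [SA' AV]; split; first exact: meets_closedI.
  by apply: subset_trans AV; exact: subIsetl.
have qI : is_bounded_cond_exp P (F (U `&` V)) \1_Q q2.
  apply: (is_bounded_cond_exp_filt fS) => //.
    by move=> A SA'; do 2 apply: meets_closedI => //.
  rewrite -SIE; apply: is_bounded_cond_exp_trans hq1 hq2.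
  by apply: sigma_XS => A [].
(* Self-adjointness, used backwards, reduces the goal to testing [q1] and [q2] against [g], which is
   what [qU] provides. *)
by rewrite -(expect_cond_exp_sym qV hgV) -(expect_cond_exp_sym qI hgI) expectC
  qU.2// expectC.
Qed.

(** The version chosen by [cond_exp] may be unbounded, so the inner one is exchanged for the almost
    surely equal bounded [yV], which has the same integrals over events of [F U]. *)
Lemma cond_exp_filtI U V Y : calA U -> calA V -> bounded_wrt (sigma_X X calA) Y ->
  cond_exp P (F U) (cond_exp P (F V) Y) = cond_exp P (F (U `&` V)) Y %[ae P].
Proof.
move=> cU cV bY.
have cI : calA (U `&` V).
  have -> : U `&` V = \bigcap_(C in [set U; V]) C.
    by rewrite bigcap_setU !bigcap_set1.
  by apply: (idx_bigcap hA) => [|C [->|->]//]; exists U; left.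
have bYM : bounded_wrt (@measurable d W) Y.
  by apply: bounded_wrtS bY; exact: sigma_X_measurable.
have [sU sV sI] := And3 (filt_sigma hF cU) (filt_sigma hF cV) (filt_sigma hF cI).
have [mU mV mI] := And3 (filt_sub hF cU) (filt_sub hF cV) (filt_sub hF cI).
have [yV hV] := is_bounded_cond_exp_exists P sV mV bYM.
have [yI hI] := is_bounded_cond_exp_exists P sI mI bYM.
have byV := bounded_wrtS mV hV.1.
have [myI iyI eyI] := is_bounded_cond_expP sU mU byV
  (is_bounded_cond_exp_filtI cU cV cI bY hV hI).
have [mE iE _] := cond_expP sV mV (bounded_wrt_integrable P bYM).
have EV := ae_eq_cond_exp sV mV bYM hV.
have EI := ae_eq_cond_exp sI mI bYM hI.
have : cond_exp P (F U) (cond_exp P (F V) Y) = yI %[ae P].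
  apply: (is_cond_exp_unique sU mU (cond_expP sU mU iE)); split=> // B UB.
  have mB := mU _ UB; rewrite eyI//; apply: ae_eq_integral => //.
  - by apply: measurable_funS (measurable_int P (bounded_wrt_integrable P byV)).
  - by apply: measurable_funS (measurable_int P iE).
  - by apply: filterS EV => w /= h _; rewrite h.
by move=> EU; apply: filterS2 EU EI => w h1 h2 _; rewrite h1// h2.
Qed.

End markov.

Theorem theorem2p3 (R : realType)
  (T : metricType R) (hT : locally_compact [set: T])
  (E : metricType R) (hE : locally_compact [set: E]) (sE : separable E)
  (calA : set (set T)) (hA : indexing_collection calA)
  (d : measure_display) (W : measurableType d) (P : probability W R)
  (cP : measure_is_complete P)
  (F : set T -> set (set W)) (hF : complete_filtration calA P F)
  (X : set T -> W -> E) (hX : C_Markov calA P F X)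
  (F_sub : forall A : set T, calA A ->
     F A `<=` <<s sigma_X X calA `|` P.-negligible >>)
  (U V : set T) (hU : calA U) (hV : calA V)
  (Y : W -> R) (mY : measurable_wrt (sigma_X X calA) (@measurable _ R) Y)
  (bY : [bounded Y w | w in [set: W]]) :
  (cond_exp P (F V) (cond_exp P (F U) Y) =
     cond_exp P (F (U `&` V)) Y %[ae P]) /\
  (cond_exp P (F U) (cond_exp P (F V) Y) =
     cond_exp P (F (U `&` V)) Y %[ae P]).
Proof.
have bY' : bounded_wrt (sigma_X X calA) Y.
  (* Boundedness in the filter sense only provides bounds strictly above [M], hence [M + 1]. *)
  split=> //; have [M [_ hM]] := bY; exists (M + 1) => w.
  by apply: hM => //; rewrite ltrDl.
split; last exact: (cond_exp_filtI hA hF hX).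
by rewrite setIC; exact: (cond_exp_filtI hA hF hX).
Qed.
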